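(* The set $\mathfrak R$ (with the usual addition and multiplication of power series) is a commutative ring which contains $\mathbb C$ and has no divisors of zero. Furthermore, let $x(t)=\sum_{n=0}^\infty x_nt^n$ be a power series (with complex coefficients) with strictly positive radius of convergence, and let $p\in\mathbb N$. Then for every $\mathbf r\in\mathfrak R^{p\times p}$ such that $\mathbf r(0)=0_{p\times p}$, the series \[ (x(\mathbf r))(z)=\sum_{n=0}^\infty x_n(\mathbf r(z))^n \] converges to a limit in $\mathfrak R^{p\times p}$. If $y(t)=\sum_{n=0}^\infty y_nt^n$ is another such power series, then \[ (xy)(\mathbf r)=x(\mathbf r)\,y(\mathbf r)\qquad\text{for all }\mathbf r\in\mathfrak R\text{ with }\mathbf r(0)=0 . \] In particular, for every $p\in\mathbb N$, an element $\mathbf s\in\mathfrak R^{p\times p}$ is invertible in $\mathfrak R^{p\times p}$ if and only if the matrix $\mathbf s(0)\in\mathbb C^{p\times p}$ is invertible.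
   Context: Let $\ell$ be the set of sequences $\alpha=(\alpha_1,\alpha_2,\ldots)$ with entries in $\{0,1,2,\ldots\}$ and only finitely many non-zero entries. For $\alpha\in\ell$ put $z^\alpha=z_1^{\alpha_1}z_2^{\alpha_2}\cdots$ (countably many complex variables $z=(z_1,z_2,\ldots)$) and $(2\mathbb N)^{\alpha}=\prod_{j\ge1}(2j)^{\alpha_j}$ (similarly $(2\mathbb N)^{c\alpha}=\prod_j(2j)^{c\alpha_j}$ for $c\in\mathbb Z$). For $k=1,2,\ldots$ let $\mathcal H_k$ be the Hilbert space of formal series $f=\sum_{\alpha\in\ell}f_\alpha H_\alpha$, $f_\alpha\in\mathbb C$, with $\|f\|_k=\left(\sum_{\alpha\in\ell}|f_\alpha|^2(2\mathbb N)^{-k\alpha}\right)^{1/2}<\infty$; here $(H_\alpha)_{\alpha\in\ell}$ is the Hermite-type orthogonal basis of the white noise space, which can be treated as formal symbols. The Kondratiev space is the inductive limit $S_{-1}=\bigcup_{k\ge1}\mathcal H_k$. The Hermite transform is $\mathbf I\left(\sum_\alpha f_\alpha H_\alpha\right)=\sum_{\alpha\in\ell}f_\alpha z^\alpha$, and $\mathfrak R=\mathbf I(S_{-1})$, i.e. the set of power series $\sum_{\alpha\in\ell}f_\alpha z^\alpha$ with $\sum_\alpha|f_\alpha|^2(2\mathbb N)^{-k\alpha}<\infty$ for some $k$. The constant coefficient of $\mathbf F\in\mathfrak R$ is denoted $\mathbf F(0)$ (entrywise for matrices); $\mathbb C$ is embedded in $\mathfrak R$ as the constant series. Convergence in $\mathfrak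 R$ (entrywise in $\mathfrak R^{p\times p}$) means convergence of the corresponding elements of $S_{-1}$. For this, the following is a known criterion: $F^{(n)}\to F$ in $S_{-1}$ if there exist $\delta>0$ and $q<\infty$ such that $\mathbf I(F^{(n)})\to\mathbf I(F)$ pointwise boundedly, or equivalently uniformly, on $K_q(\delta)=\{z\in\mathbb C^{\mathbb N}:\ \sum_{\alpha\in\ell,\ \alpha\neq(0,0,\ldots)}|z^\alpha|^2(2\mathbb N)^{q\alpha}<\delta^2\}$. *)

(* Defs.v *)
From HB Require Import structures.
From mathcomp Require Import all_boot all_order all_algebra finmap.
From mathcomp Require Import all_classical all_reals all_analysis.
From mathcomp.real_closed Require Export complex.

Set Implicit Arguments.
Unset Strict Implicit.
Unset Printing Implicit Defensive.
Import Order.TTheory GRing.Theory Num.Theory.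
Import numFieldNormedType.Exports.
Local Open Scope classical_set_scope.
Local Open Scope ring_scope.

(* Finitely supported sequences of natural numbers, with pointwise addition.
   Positions are counted from 0: [a i] is the exponent of the variable
   $z_{i+1}$. *)
Definition mindex := {fsfun nat -> nat with 0%N}.

HB.instance Definition _ := Choice.on mindex.

Definition mindex_add (a b : mindex) : mindex :=
  [fsfun i in (finsupp a `|` finsupp b)%fset => (a i + b i)%N].

Definition mindex0 : mindex := [fsfun].

Lemma mindex_addE (a b : mindex) i : mindex_add a b i = (a i + b i)%N.
Proof.
by rewrite fsfun_fun in_fsetE; case: (finsuppP a); case: (finsuppP b).
Qed.

Lemma mindex0E i : mindex0 i = 0%N.
Proof. by rewrite fsfun0E. Qed.

Fact mindex_addA : associative mindex_add.
Proof. by move=> a b c; apply/fsfunP => i; rewrite !mindex_addE addnA. Qed.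

Fact mindex_addC : commutative mindex_add.
Proof. by move=> a b; apply/fsfunP => i; rewrite !mindex_addE addnC. Qed.

Fact mindex_add0 : left_id mindex0 mindex_add.
Proof. by move=> a; apply/fsfunP => i; rewrite mindex_addE mindex0E. Qed.

HB.instance Definition _ :=
  GRing.isNmodule.Build mindex mindex_addA mindex_addC mindex_add0.

Lemma mindexDE (a b : mindex) i : (a + b) i = (a i + b i)%N.
Proof. exact: mindex_addE. Qed.

Lemma mindex_addI (a : mindex) : injective (+%R a).
Proof.
move=> b c /fsfunP h; apply/fsfunP => i.
by have := h i; rewrite !mindexDE => /addnI.
Qed.

Lemma finite_mindex_le (a : mindex) :
  finite_set [set b : mindex | exists c, b + c = a].
Proof.
pose S := finsupp a; pose N := (\max_(i <- S) a i).+1.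
pose F (g : {ffun S -> 'I_N}) : mindex := [fsfun i : S => val (g i)].
apply: (@sub_finite_set _ _ (F @` setT)); last exact/finite_image/finite_finset.
move=> b [c bca]; have ba i : (b i <= a i)%N by rewrite -bca mindexDE leq_addr.
have aN i : (a i < N)%N.
  rewrite ltnS; have [iS|iS] := boolP (i \in S); last by rewrite fsfun_dflt.
  exact: (@leq_bigmax_seq _ (enum_fset S) xpredT (fun i => a i)).
exists [ffun i => Ordinal (leq_ltn_trans (ba (val i)) (aN (val i)))] => //.
apply/fsfunP => i; rewrite /F fsfun_ffun; case: insubP => [j _ <-|iS].
  by rewrite /= ffunE.
by apply/esym/eqP; rewrite -leqn0 (leq_trans (ba i)) // fsfun_dflt.
Qed.

(* $(2\mathbb N)^\alpha$ *)
Definition twoN (R : realType) (a : mindex) : R :=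
  \prod_(i <- finsupp a) (2 * i.+1)%:R ^+ a i.

(* Formal power series in countably many variables over the complex numbers,
   given by their coefficient families.  The Hermite transform turns the
   series $\sum f_\alpha H_\alpha$ into $\sum f_\alpha z^\alpha$, that is, it
   is the identity on coefficient families: [fps R] stands for both. *)
Definition fps (R : realType) : Type := mindex -> R[i].

HB.instance Definition _ (R : realType) :=
  Choice.copy (fps R) (mindex -> R[i]).
HB.instance Definition _ (R : realType) :=
  GRing.Zmodule.copy (fps R) (mindex -> R[i]).

Section FpsRing.
Variable R : realType.
Implicit Types (f g h : fps R) (a b c : mindex).

Definition fps_one : fps R := fun a => (a == 0)%:R.

(* The index set is finite by [finite_mindex_le]. *)
Definition fps_mul f g : fps R := fun a =>
  \sum_(bc \in [set bc : mindex * mindex | bc.1 + bc.2 = a])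
     f bc.1 * g bc.2.

Definition fps_scale (z : R[i]) f : fps R := fun a => z * f a.

Let lower a : seq mindex := fset_set [set b : mindex | exists c, b + c = a].

Let mem_lower a b : (b \in lower a) = `[< exists c, b + c = a >].
Proof.
rewrite /lower in_fset_set; last exact: finite_mindex_le.
by apply/idP/asboolP; rewrite inE.
Qed.

Let lower_add a b c : b + c \in lower a -> (b \in lower a) * (c \in lower a).
Proof.
rewrite !mem_lower => /asboolP[d e]; split; apply/asboolP.
  by exists (c + d); rewrite addrA.
by exists (b + d); rewrite addrCA addrA.
Qed.

Let lower_refl a : a \in lower a.
Proof. by rewrite mem_lower; apply/asboolP; exists 0; rewrite addr0. Qed.

Let fps_mulE a f g b : b \in lower a ->
  fps_mul f g b = \sum_(c <- lower a) \sum_(d <- lower a)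
                     (if c + d == b then f c * g d else 0).
Proof.
move=> ba; rewrite /fps_mul (@fsbigE _ _ _ _ _
  [seq p <- [seq (c, d) | c <- lower a, d <- lower a] | p.1 + p.2 == b]).
- rewrite big_filter_cond big_mkcond /= big_allpairs; apply: eq_bigr => c _.
  apply: eq_bigr => d _ /=; case: eqP => //= cdb.
  by rewrite mem_set.
- apply: filter_uniq; apply: allpairs_uniq; [exact: fset_uniq..|].
  by move=> [? ?] [? ?].
- by move=> p /=; rewrite mem_filter => /andP[/eqP].
- move=> [c d] /= cdb; rewrite mem_filter cdb eqxx /= => /allpairsP[].
  by exists (c, d) => /=; move: ba; rewrite -cdb => /lower_add[-> ->].
Qed.

Fact fps_mulC : commutative fps_mul.
Proof.
move=> f g; apply/funext => a; rewrite !(fps_mulE _ _ (lower_refl a)).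
rewrite exchange_big /=; apply: eq_bigr => c _; apply: eq_bigr => d _.
by rewrite addrC mulrC.
Qed.

Fact fps_mulA : associative fps_mul.
Proof.
move=> f g h; apply/funext => a; rewrite !(fps_mulE _ _ (lower_refl a)).
set D := lower a.
pose T b c d := f b * (g c * h d).
have uD : uniq D by exact: fset_uniq.
transitivity (\sum_(b <- D) \sum_(c <- D) \sum_(d <- D)
                (if b + (c + d) == a then T b c d else 0)).
  apply: eq_big_seq => b _.
  transitivity (\sum_(e <- D) \sum_(c <- D) \sum_(d <- D)
     (if (b + e == a) && (c + d == e) then T b c d else 0)).
    apply: eq_big_seq => e eD; case: ifP => /= be; last first.
      by rewrite big1 // => c _; rewrite big1.
    rewrite (fps_mulE _ _ eD) big_distrr; apply: eq_bigr => c _ /=.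
    by rewrite big_distrr; apply: eq_bigr => d _ /=; case: ifP; rewrite ?mulr0.
  rewrite exchange_big; apply: eq_bigr => c _ /=.
  rewrite exchange_big; apply: eq_bigr => d _ /=.
  case: eqP => [e|ne].
    have cdD : c + d \in D by move: (lower_refl a); rewrite -{1}e => /lower_add[].
    rewrite (bigD1_seq (c + d)) //= e !eqxx /= big1 ?addr0 // => x.
    by rewrite eq_sym => /negbTE->; rewrite andbF.
  rewrite big1 // => x _; case: ifP => // /andP[/eqP bx /eqP cx].
  by case: ne; rewrite cx.
transitivity (\sum_(d <- D) \sum_(b <- D) \sum_(c <- D)
                (if b + (c + d) == a then T b c d else 0)).
  rewrite [RHS]exchange_big; apply: eq_bigr => b _ /=.
  by rewrite exchange_big.
rewrite [RHS]exchange_big; apply: eq_big_seq => d _ /=; symmetry.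
transitivity (\sum_(e <- D) \sum_(b <- D) \sum_(c <- D)
     (if (e + d == a) && (b + c == e) then T b c d else 0)).
  apply: eq_big_seq => e eD; case: ifP => /= be; last first.
    by rewrite big1 // => c _; rewrite big1.
  rewrite (fps_mulE _ _ eD) big_distrl; apply: eq_bigr => b _ /=.
  rewrite big_distrl; apply: eq_bigr => c _ /=.
  by case: ifP; rewrite ?mul0r // /T mulrA.
rewrite exchange_big; apply: eq_bigr => b _ /=.
rewrite exchange_big; apply: eq_bigr => c _ /=.
rewrite addrA; case: eqP => [e|ne].
  have cdD : b + c \in D by move: (lower_refl a); rewrite -{1}e => /lower_add[].
  rewrite (bigD1_seq (b + c)) //= e !eqxx /= big1 ?addr0 // => x.
  by rewrite eq_sym => /negbTE->; rewrite andbF.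
rewrite big1 // => x _; case: ifP => // /andP[/eqP bx /eqP cx].
by case: ne; rewrite cx.
Qed.

Fact fps_mul1 : left_id fps_one fps_mul.
Proof.
move=> f; apply/funext => a; rewrite (fps_mulE _ _ (lower_refl a)).
have D0 : 0 \in lower a.
  by rewrite mem_lower; apply/asboolP; exists a; rewrite add0r.
rewrite (bigD1_seq 0) ?fset_uniq //= [X in _ + X]big1 ?addr0; last first.
  move=> c c0; rewrite big1 // => d _.
  by rewrite /fps_one (negbTE c0) mul0r if_same.
rewrite (bigD1_seq a) ?fset_uniq ?lower_refl //= add0r eqxx /fps_one eqxx mul1r.
by rewrite big1 ?addr0 // => d /negbTE; rewrite add0r => ->.
Qed.

Fact fps_mulDl : left_distributive fps_mul +%R.
Proof.
move=> f g h; apply/funext => a.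
rewrite -[RHS]/(fps_mul f h a + fps_mul g h a).
rewrite !(fps_mulE _ _ (lower_refl a)) -big_split; apply: eq_bigr => c _ /=.
rewrite -big_split; apply: eq_bigr => d _ /=.
by case: ifP => _; rewrite ?addr0 // -mulrDl.
Qed.

Fact fps_one_neq0 : fps_one != 0.
Proof.
apply/eqP => /(congr1 (fun f : fps R => f 0)) /eqP.
by rewrite /fps_one eqxx oner_eq0.
Qed.

HB.instance Definition _ := GRing.Zmodule_isComNzRing.Build (fps R)
  fps_mulA fps_mulC fps_mul1 fps_mulDl fps_one_neq0.

Fact fps_scaleA z w f : fps_scale z (fps_scale w f) = fps_scale (z * w) f.
Proof. by apply/funext => a; rewrite /fps_scale mulrA. Qed.

Fact fps_scale1 : left_id 1 fps_scale.
Proof. by move=> f; apply/funext => a; rewrite /fps_scale mul1r. Qed.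

Fact fps_scaleDr : right_distributive fps_scale +%R.
Proof. by move=> z f g; apply/funext => a; rewrite /fps_scale mulrDr. Qed.

Fact fps_scaleDl f : {morph fps_scale^~ f : z w / z + w}.
Proof. by move=> z w; apply/funext => a; rewrite /fps_scale mulrDl. Qed.

HB.instance Definition _ := GRing.Zmodule_isLmodule.Build R[i] (fps R)
  fps_scaleA fps_scale1 fps_scaleDr fps_scaleDl.

Fact fps_scaleAl (z : R[i]) (f g : fps R) : z *: (f * g) = z *: f * g.
Proof.
apply/funext => a; rewrite -[LHS]/(z * fps_mul f g a).
rewrite -[RHS]/(fps_mul (fps_scale z f) g a).
rewrite !(fps_mulE _ _ (lower_refl a)) big_distrr; apply: eq_bigr => c _ /=.
rewrite big_distrr; apply: eq_bigr => d _ /=.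
by case: ifP => _; rewrite ?mulr0 // mulrA.
Qed.

HB.instance Definition _ := GRing.Lmodule_isLalgebra.Build R[i] (fps R)
  fps_scaleAl.

(* The value at z = 0.  The embedding of the complex numbers as constant
   series is [z%:A]. *)
Definition const_coef f : R[i] := f 0.

End FpsRing.

Section Kondratiev.
Variable R : realType.
Implicit Types (f g : fps R) (k : nat) (V : set (fps R)).

Definition hnorm k f : \bar R :=
  ((\esum_(a in [set: mindex]) ((Normc.normc (f a)) ^+ 2 * twoN R a ^- k)%:E)
     `^ 2^-1)%E.

Definition kondratiev : {pred fps R} :=
  [pred f : fps R | `[< exists2 k, (0 < k)%N & (hnorm k f < +oo)%E >]].

Definition absolutely_convex V := forall f g, V f -> V g ->
  forall z w : R[i], `|z| + `|w| <= 1 -> V (z *: f + w *: g).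

(* A base of neighbourhoods of 0 for the locally convex inductive limit
   topology of the union of the spaces $\mathcal H_k$: the absolutely convex
   sets that meet every $\mathcal H_k$ in a neighbourhood of 0. *)
Definition indlim_nbhs0 V :=
  [/\ forall f, V f -> f \in kondratiev,
      absolutely_convex V
    & forall k, (0 < k)%N ->
        exists2 e : R, 0 < e & forall f, (hnorm k f < e%:E)%E -> V f].

Definition indlim_cvg (u : nat -> fps R) f :=
  f \in kondratiev /\
  forall V, indlim_nbhs0 V -> \forall n \near \oo, V (u n - f).

End Kondratiev.

Arguments kondratiev R : clear implicits.

Section FunctionalCalculus.
Variable R : realType.
Implicit Types x y : nat -> R[i].

(* The supremum of the absolute values of the points of convergence.  The norm
   topology is attached to [R[i]^o], not to [R[i]]. *)
Definition conv_radius x : \bar R :=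
  ereal_sup [set (Normc.normc t)%:E |
    t in [set t : R[i] | cvgn (series (fun n => x n * t ^+ n) : nat -> R[i]^o)]].

Definition cauchy_prod x y : nat -> R[i] :=
  fun n => \sum_(k < n.+1) x k * y (n - k)%N.

(* [X] is the sum $x(\mathbf r)$ of the series with terms $x_n \mathbf r^n$. *)
Definition funcalc p x (r X : 'M[fps R]_p) :=
  forall i j,
    indlim_cvg (fun N => (\sum_(n < N) (x n)%:A *: r ^+ n) i j) (X i j).

End FunctionalCalculus.

(* Main.v *)
Require Import Defs.
From HB Require Import structures.
From mathcomp Require Import all_boot all_order all_algebra finmap.
From mathcomp Require Import all_classical all_reals all_analysis.
From mathcomp.real_closed Require Import complex.
From mathcomp Require Import ring lra.
Set Implicit Arguments.
Unset Strict Implicit.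
Unset Printing Implicit Defensive.
Import Order.TTheory GRing.Theory Num.Theory.
Import numFieldNormedType.Exports.
Local Open Scope classical_set_scope.
Local Open Scope ring_scope.

(** The Kondratiev space is the union of the spaces $\mathcal H_k$, but it is
    also the union of the Banach algebras of series whose weighted $\ell^1$ norm
    $\sum_\alpha |f_\alpha| (2\mathbb N)^{-k\alpha}$ is finite for some [k]
    ([kondratievP]).  The two scales of spaces are cofinal because
    $\sum_\alpha (2\mathbb N)^{-2\alpha}$ converges ([sum_twoN_le2]): it is the
    Wallis product.  The $\ell^1$ norms are submultiplicative because
    $(2\mathbb N)^{\alpha+\beta} = (2\mathbb N)^\alpha (2\mathbb N)^\beta$, so
    the union is a ring.  It has no zero divisors because the ring of all formal
    power series has none: of the products of coefficients that contribute to a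
    suitably chosen coefficient of [f * g], exactly one is nonzero
    ([unique_sum], [fps_integral]).

    Let [r] have no constant term.  Every nonconstant monomial has weight at
    least 2, so raising the level by [m] divides the $\ell^1$ norm of [r] by at
    least $2^m$ ([l1le_shrink]).  At a high enough level, [r] is therefore
    smaller than any given positive radius of convergence, and the series
    $\sum_n x_n r^n$ converges geometrically in the norm of that level
    ([formal_sum_l1le]), hence in the inductive limit ([indlim_cvg_l1le]).

    On the other hand [r ^+ n] vanishes to order [n], so each coefficient of the
    partial sums is eventually constant.  Since the coefficients are continuous
    on the inductive limit ([indlim_cvg_coef]), the sum is the formal one
    ([funcalc_formal_sum]), which gives its uniqueness and turns the identity
    $(xy)(r) = x(r) y(r)$ into a statement about truncated polynomials
    ([spsum_mul]).

    Finally, taking constant coefficients is a ring morphism, so an invertible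
    matrix has an invertible constant part.  Conversely, a series [d] with
    nonzero constant coefficient is inverted by the geometric series in
    [1 - d / d(0)] ([kondratiev_inv]), and applying this to the determinant
    inverts a matrix by means of its adjugate. *)

(** * Multi-indices and their weights *)

Section Weights.
Variable R : realType.
Implicit Types a b : mindex.

Lemma twoN_widen (S : {fset nat}) a : (finsupp a `<=` S)%fset ->
  twoN R a = \prod_(i <- S) (2 * i.+1)%:R ^+ a i.
Proof.
move=> aS; rewrite /twoN; apply: (big_fset_incl _ aS) => i _ iNa.
by rewrite fsfun_dflt ?expr0.
Qed.

Lemma twoN_gt0 a : 0 < twoN R a.
Proof. by apply: prodr_gt0 => i _; rewrite exprn_gt0 // ltr0n muln_gt0. Qed.

Lemma twoN0 : twoN R 0 = 1.
Proof. by rewrite /twoN big1 // => i _; rewrite mindex0E expr0. Qed.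

Lemma twoND a b : twoN R (a + b) = twoN R a * twoN R b.
Proof.
set c := a + b; pose S := (finsupp a `|` finsupp b `|` finsupp c)%fset.
rewrite (@twoN_widen S c) ?fsubsetUr // (@twoN_widen S a); last first.
  by rewrite /S -fsetUA fsubsetUl.
rewrite (@twoN_widen S b); last by rewrite /S fsetUAC fsubsetUr.
by rewrite -big_split; apply: eq_bigr => i _; rewrite mindexDE exprD.
Qed.

Lemma twoN_ge1 a : 1 <= twoN R a.
Proof.
rewrite /twoN; elim/big_rec: _ => // i x _ x1.
by rewrite mulr_ege1 // exprn_ege1 // ler1n muln_gt0.
Qed.

Lemma twoN_ge2 a : a != 0 -> 2 <= twoN R a.
Proof.
move=> a0; have [i ai] : exists i, a i != 0%N.
  apply: contrapT => /forallNP h; move/eqP: a0; apply; apply/fsfunP => i.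
  by rewrite mindex0E; apply/eqP/negPn/negP; exact: h.
have ia : i \in finsupp a by rewrite mem_finsupp.
rewrite /twoN (big_fsetD1 i) //= -[2]mulr1 ler_pM ?ler0n //.
  case: (a i) ai => // n _; rewrite exprS -[2]mulr1 ler_pM ?ler0n //.
    by rewrite ler_nat leq_pmulr.
  by rewrite exprn_ege1 // ler1n muln_gt0.
elim/big_rec: _ => // j x _ x1.
by rewrite mulr_ege1 // exprn_ege1 // ler1n muln_gt0.
Qed.

End Weights.

Section Normc.
Variable R : realType.
Implicit Types z w : R[i].

Lemma normc_ge0 z : 0 <= Normc.normc z.
Proof. by case: z => x y; exact: sqrtr_ge0. Qed.

Lemma normc_sum (I : Type) (s : seq I) (F : I -> R[i]) :
  Normc.normc (\sum_(i <- s) F i) <= \sum_(i <- s) Normc.normc (F i).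
Proof.
elim/big_rec2: _ => [|i y x _ xy]; first by rewrite Normc.normc0.
by apply: le_trans (le_normcD _ _) _; rewrite lerD2l.
Qed.

End Normc.

(** * Products of formal power series *)

Section Product.
Variable R : realType.
Implicit Types (f g : fps R) (a b c : mindex).

Lemma fps_mulE (D : seq mindex) f g a : uniq D ->
    (forall b c, b + c = a -> b \in D /\ c \in D) ->
  (f * g) a = \sum_(b <- D) \sum_(c <- D)
                (if b + c == a then f b * g c else 0).
Proof.
move=> uD aD; rewrite -[LHS]/(fps_mul f g a) /fps_mul (@fsbigE _ _ _ _ _
  [seq p <- [seq (c, d) | c <- D, d <- D] | p.1 + p.2 == a]).
- rewrite big_filter_cond big_mkcond /= big_allpairs; apply: eq_bigr => c _.
  apply: eq_bigr => d _ /=; case: eqP => //= cda.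
  by rewrite mem_set.
- by apply: filter_uniq; apply: allpairs_uniq => // -[? ?] [? ?].
- by move=> p /=; rewrite mem_filter => /andP[/eqP].
- move=> [c d] /= cda; rewrite mem_filter cda eqxx /= => /allpairsP[].
  by exists (c, d); have [] := aD _ _ cda.
Qed.

(** A common finite index set for several coefficients, so that a sum of
    coefficients of a product can be rearranged as a finite double sum. *)
Lemma mindex_lower (s : seq mindex) : exists2 D : seq mindex, uniq D &
  forall a, a \in s -> forall b c, b + c = a -> b \in D /\ c \in D.
Proof.
pose L a : seq mindex := fset_set [set b : mindex | exists c, b + c = a].
have memL a b c : b + c = a -> b \in L a.
  move=> bca; rewrite /L in_fset_set; last exact: finite_mindex_le.
  by rewrite inE; exists c.
exists (undup (flatten (map L s))); first exact: undup_uniq.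
move=> a sa b c bca; rewrite !mem_undup; split; apply/flatten_mapP; exists a => //.
  exact: memL bca.
by apply: (memL _ _ b); rewrite addrC.
Qed.

Lemma fps_mul_eq0 f g a : (forall b c, b + c = a -> f b * g c = 0) ->
  (f * g) a = 0.
Proof.
move=> fg0; have [D uD aD] := mindex_lower [:: a].
rewrite (fps_mulE f g uD (aD _ (mem_head _ _))).
by rewrite big1 // => b _; rewrite big1 // => c _; case: eqP => // /fg0.
Qed.

(** The way in which a single product of coefficients is isolated, both for
    the constant term and for the proof that there are no zero divisors. *)
Lemma fps_mul_single f g a b c : b + c = a ->
    (forall b' c', b' + c' = a -> f b' * g c' != 0 -> b' = b /\ c' = c) ->
  (f * g) a = f b * g c.
Proof.
move=> bca single; have [D uD aD] := mindex_lower [:: a].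
have {}aD := aD _ (mem_head _ _); have [bD cD] := aD _ _ bca.
rewrite (fps_mulE f g uD aD) (bigD1_seq b) //= (bigD1_seq c) //= bca eqxx.
rewrite !big1 ?addr0 // => [b' b'b|c' c'c].
  rewrite big1 // => c' _; case: eqP => // e.
  apply/eqP; apply: contraNT b'b => n0.
  by have [-> _] := single _ _ e n0.
case: eqP => // e; apply/eqP; apply: contraNT c'c => n0.
by have [_ ->] := single _ _ e n0.
Qed.

Lemma const_coefM f g :
  const_coef (f * g) = const_coef f * const_coef g.
Proof.
apply: fps_mul_single; first exact: addr0.
move=> b c bc0 _; suff e : b = 0 by move: bc0; rewrite e add0r.
apply/fsfunP => i; have /fsfunP /(_ i) := bc0.
by rewrite mindexDE mindex0E => /eqP; rewrite addn_eq0 => /andP[/eqP].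
Qed.

Fact const_coef_is_zmod_morphism : zmod_morphism (@const_coef R).
Proof. by []. Qed.

Fact const_coef_is_monoid_morphism : monoid_morphism (@const_coef R).
Proof.
split; last exact: const_coefM.
by rewrite /const_coef -[LHS]/((0 == 0 :> mindex)%:R) eqxx.
Qed.

HB.instance Definition _ := GRing.isZmodMorphism.Build (fps R) R[i]
  (@const_coef R) const_coef_is_zmod_morphism.
HB.instance Definition _ := GRing.isMonoidMorphism.Build (fps R) R[i]
  (@const_coef R) const_coef_is_monoid_morphism.

Lemma fps_algE (z : R[i]) a : (z%:A : fps R) a = z * (a == 0)%:R.
Proof. by []. Qed.

Lemma fpsDE f g a : (f + g) a = f a + g a. Proof. by []. Qed.
Lemma fpsNE f a : (- f) a = - f a. Proof. by []. Qed.

End Product.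

(** * Summability of the weights *)

Section WeightSum.
Variable R : realType.

Let scale (i : nat) : R := (2 * i.+1)%:R.

Lemma geometric_sum_le (x : R) n : 0 <= x -> x < 1 ->
  \sum_(i < n) x ^+ i <= (1 - x)^-1.
Proof.
move=> x0 x1; have x1' : 0 < 1 - x by rewrite subr_gt0.
rewrite -[leRHS]mul1r ler_pdivlMr // mulrC -opprB mulNr -subrX1 opprB.
by rewrite lerBlDr lerDl exprn_ge0.
Qed.

Lemma scale_ge2 i : 2 <= scale i.
Proof. by rewrite /scale ler_nat leq_pmulr. Qed.

Lemma scaleV2_lt1 i : (scale i ^+ 2)^-1 < 1.
Proof.
have := scale_ge2 i; move: (scale i) => x x2.
by rewrite invf_lt1 ?exprn_gt0 ?(lt_le_trans _ x2) // expr2; nra.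
Qed.

(** A partial product of the Wallis product for $\pi/2$; the sharper bound
   $(2n+1)/(n+1)$ is the one that an induction can prove. *)
Lemma wallis_prod_le2 n : \prod_(i < n) (1 - (scale i ^+ 2)^-1)^-1 <= 2.
Proof.
have step (t : R) : 0 <= t ->
    (2 * t + 1) / (t + 1) / (1 - ((2 * (t + 1)) ^+ 2)^-1) =
    (2 * (t + 1) + 1) / (t + 1 + 1) - ((2 * t + 3) * (t + 2))^-1.
  move=> t0; have [n1 n2 n3 n4] : [/\ t + 1 != 0, t + 2 != 0, 2 * t + 3 != 0
      & 2 * t + 1 != 0] by split; rewrite gt_eqF //; lra.
  have -> : 1 - ((2 * (t + 1)) ^+ 2)^-1 =
            (2 * t + 1) * (2 * t + 3) / (4 * (t + 1) ^+ 2).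
    by field.
  have -> : t + 1 + 1 = t + 2 by lra.
  by field; rewrite n1 n2 n3 n4.
suff h : \prod_(i < n) (1 - (scale i ^+ 2)^-1)^-1 <= (2 * n%:R + 1) / (n%:R + 1).
  apply: le_trans h _; have n0 := ler0n R n.
  by rewrite ler_pdivrMr ?ltr_wpDl //; lra.
elim: n => [|n IH]; first by rewrite big_ord0 mulr0 add0r divr1.
rewrite big_ord_recr /=.
have t0 : 0 <= n%:R :> R := ler0n R n.
apply: le_trans (ler_wpM2r _ IH) _.
  by rewrite invr_ge0 subr_ge0 ltW // scaleV2_lt1.
have -> : scale n = 2 * (n%:R + 1) by rewrite /scale natrM natr1.
rewrite step // -[n.+1%:R]natr1 lerBlDr lerDl invr_ge0 mulr_ge0 //; lra.
Qed.

(** Zhang's theorem at exponent 2: over the multi-indices in finitely many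
    variables with bounded exponents, the sum of the weights factors into
    geometric series, one per variable. *)
Lemma sum_twoN_le2 (s : seq mindex) : uniq s ->
  \sum_(a <- s) (twoN R a ^+ 2)^-1 <= 2.
Proof.
move=> us; pose N := (\max_(a <- s) \max_(i <- finsupp a) (i + a i)).+1.
have sN a i : a \in s -> i \in finsupp a -> (i + a i < N)%N.
  move=> sa ia; rewrite ltnS.
  apply: (@leq_trans (\max_(i <- finsupp a) (i + a i))).
    exact: (@leq_bigmax_seq _ _ xpredT (fun i => i + a i)%N).
  exact: (@leq_bigmax_seq _ s xpredT
            (fun a => \max_(i <- finsupp a) (i + a i))%N).
have sN1 (a : mindex) i : a \in s -> (a i < N)%N.
  move=> sa; have [ia|ia] := boolP (i \in finsupp a); last by rewrite fsfun_dflt.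
  by apply: leq_ltn_trans (sN _ _ sa ia); rewrite leq_addl.
have supp a : a \in s -> {subset finsupp a <= iota 0 N}.
  move=> sa i ia; rewrite mem_iota.
  by apply: leq_ltn_trans (sN _ _ sa ia); rewrite leq_addr.
pose h (a : mindex) : {ffun 'I_N -> 'I_N} := [ffun i : 'I_N => inord (a i)].
have hE a i : a \in s -> h a i = a i :> nat.
  by move=> sa; rewrite ffunE inordK // -/N sN1.
pose G (g : {ffun 'I_N -> 'I_N}) : R := \prod_(i < N) (scale i ^+ 2)^-1 ^+ g i.
have twoNE a : a \in s -> (twoN R a ^+ 2)^-1 = G (h a).
  move=> sa; rewrite (@twoN_widen _ [fset i in iota 0 N]%fset a); last first.
    by apply/fsubsetP => i ia; rewrite in_fset; exact: supp ia.
  rewrite (perm_big (iota 0 N)); last first.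
    apply: uniq_perm; [exact: fset_uniq|exact: iota_uniq|].
    by move=> i; rewrite in_fset.
  rewrite -[iota 0 N]/(index_iota 0 N) big_mkord -prodrXl -prodfV.
  by apply: eq_bigr => i _; rewrite hE // exprVn exprAC.
rewrite (eq_big_seq _ twoNE) -(big_map h xpredT G) /=.
have uh : uniq (map h s).
  rewrite map_inj_in_uniq // => a b sa sb hab; apply/fsfunP => i.
  have [iN|iN] := boolP (i \in iota 0 N).
    move: iN; rewrite mem_iota /= => iN.
    by rewrite -(hE a (Ordinal iN) sa) -(hE b (Ordinal iN) sb) hab.
  by rewrite !fsfun_dflt //; apply: contra iN; apply: supp.
have G0 g : 0 <= G g.
  by apply: prodr_ge0 => i _; rewrite exprn_ge0 // invr_ge0 sqr_ge0.
rewrite big_uniq //= big_mkcond /=.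
apply: (@le_trans _ _ (\sum_g G g)).
  by apply: ler_sum => g _; case: ifP.
rewrite /G -(bigA_distr_bigA (fun i j : 'I_N => (scale i ^+ 2)^-1 ^+ j)).
apply: le_trans (wallis_prod_le2 N); apply: ler_prod => i _; apply/andP; split.
  by apply: sumr_ge0 => j _; rewrite exprn_ge0 // invr_ge0 sqr_ge0.
by apply: geometric_sum_le; rewrite ?scaleV2_lt1 // invr_ge0 sqr_ge0.
Qed.

End WeightSum.

(** * Weighted summable series *)

Section WeightedL1.
Variable R : realType.
Implicit Types (f g : fps R) (k : nat) (C : R).

(** Weighted $\ell^1$ norms are submultiplicative, unlike the norms of the
    $\mathcal H_k$, because the weight is multiplicative.  Bounding finite
    partial sums avoids summability side conditions. *)
Definition l1le k C f := forall s : seq mindex, uniq s ->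
  \sum_(a <- s) Normc.normc (f a) / twoN R a ^+ k <= C.

Let term_ge0 k f a : 0 <= Normc.normc (f a) / twoN R a ^+ k.
Proof. by rewrite divr_ge0 ?normc_ge0 ?exprn_ge0 // ltW ?twoN_gt0. Qed.

Lemma l1le_ge0 k C f : l1le k C f -> 0 <= C.
Proof. by move=> /(_ [::] isT); rewrite big_nil. Qed.

Lemma l1le_trans k C D f : C <= D -> l1le k C f -> l1le k D f.
Proof. by move=> CD fC s us; exact: le_trans (fC s us) CD. Qed.

Lemma l1leD k C D f g : l1le k C f -> l1le k D g -> l1le k (C + D) (f + g).
Proof.
move=> fC gD s us; apply: le_trans (lerD (fC s us) (gD s us)).
rewrite -big_split; apply: ler_sum => a _ /=.
rewrite -mulrDl ler_wpM2r ?le_normcD // invr_ge0 exprn_ge0 //.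
by rewrite ltW ?twoN_gt0.
Qed.

Lemma l1leN k C f : l1le k C f -> l1le k C (- f).
Proof.
move=> fC s us; apply: le_trans (fC s us); apply: ler_sum => a _.
by rewrite normcN.
Qed.

Lemma l1leZ k C (z : R[i]) f : l1le k C f -> l1le k (Normc.normc z * C) (z *: f).
Proof.
move=> fC s us; have /(ler_wpM2l (normc_ge0 z)) := fC s us.
apply: le_trans; rewrite big_distrr; apply: ler_sum => a _ /=.
by rewrite -[(z *: f) a]/(z * f a) Normc.normcM mulrA.
Qed.

Lemma l1le_sum k (I : Type) (s : seq I) (F : I -> fps R) (C : I -> R) :
  (forall i, l1le k (C i) (F i)) -> l1le k (\sum_(i <- s) C i) (\sum_(i <- s) F i).
Proof.
move=> FC; elim/big_rec2: _ => [|i f D _ fD]; last exact: l1leD.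
by move=> t ut; rewrite big1 // => a _; rewrite Normc.normc0 mul0r.
Qed.

Let sum_pred1_le (s : seq mindex) x (y : R) : uniq s -> 0 <= y ->
  \sum_(a <- s) (if x == a then y else 0) <= y.
Proof.
move=> us y0; have [xs|xs] := boolP (x \in s).
  rewrite (bigD1_seq x) //= eqxx big1 ?addr0 // => a.
  by rewrite eq_sym => /negbTE ->.
rewrite big_seq big1 // => a sa; case: eqP => // xa.
by rewrite xa sa in xs.
Qed.

Lemma l1le1 k : l1le k 1 (1 : fps R).
Proof.
move=> s us; apply: le_trans (sum_pred1_le 0 us ler01).
apply: ler_sum => a _; rewrite -[(1 : fps R) a]/((a == 0)%:R) eq_sym.
case: eqP => [<-|_]; last by rewrite Normc.normc0 mul0r.
by rewrite Normc.normc1 twoN0 expr1n divr1.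
Qed.

Lemma l1leM k C D f g : l1le k C f -> l1le k D g -> l1le k (C * D) (f * g).
Proof.
move=> fC gD s us; have [E uE sE] := mindex_lower s.
pose F a := Normc.normc (f a) / twoN R a ^+ k.
pose G a := Normc.normc (g a) / twoN R a ^+ k.
apply: (@le_trans _ _ (\sum_(a <- s) \sum_(b <- E) \sum_(c <- E)
           (if b + c == a then F b * G c else 0))).
  rewrite big_seq [leRHS]big_seq; apply: ler_sum => a sa.
  rewrite (fps_mulE f g uE (sE a sa)) ler_pdivrMr; last first.
    by rewrite exprn_gt0 ?twoN_gt0.
  apply: le_trans (normc_sum _ _) _; rewrite big_distrl.
  apply: ler_sum => b _; apply: le_trans (normc_sum _ _) _.
  rewrite big_distrl; apply: ler_sum => c _ /=.
  case: eqP => [<-|_]; last by rewrite Normc.normc0 mul0r.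
  rewrite Normc.normcM twoND exprMn /F /G mulf_div divfK //.
  by rewrite mulf_neq0 // expf_neq0 // gt_eqF ?twoN_gt0.
rewrite exchange_big /=.
have S0 h : 0 <= \sum_(b <- E) Normc.normc (h b) / twoN R b ^+ k.
  by apply: sumr_ge0 => b _; exact: term_ge0.
apply: le_trans (ler_pM (S0 f) (S0 g) (fC E uE) (gD E uE)).
rewrite big_distrl; apply: ler_sum => b _ /=.
rewrite exchange_big big_distrr /=; apply: ler_sum => c _.
by apply: sum_pred1_le us _; rewrite mulr_ge0 ?term_ge0.
Qed.

Lemma l1le_add k m C f : l1le k C f -> l1le (k + m) C f.
Proof.
move=> fC s us; apply: le_trans (fC s us); apply: ler_sum => a _.
rewrite exprD invfM mulrA ler_piMr // invf_le1 ?exprn_gt0 ?twoN_gt0 //.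
by rewrite exprn_ege1 ?twoN_ge1.
Qed.

(** Without constant term, [f] becomes as small as desired at a large enough
    level, because every weight other than the one of the constant term is at
    least 2.  This is what makes every power series with a positive radius of
    convergence applicable to [f]. *)
Lemma l1le_shrink k m C f : const_coef f = 0 -> l1le k C f ->
  l1le (k + m) (C / 2 ^+ m) f.
Proof.
move=> f0 fC s us; have /(ler_wpM2r _) := fC s us.
have i2 : 0 <= (2 ^+ m)^-1 :> R by rewrite invr_ge0 exprn_ge0.
move=> /(_ _ i2); apply: le_trans; rewrite big_distrl; apply: ler_sum => a _ /=.
have [->|a0] := eqVneq a 0.
  by rewrite -[f 0]/(const_coef f) f0 Normc.normc0 !mul0r.
rewrite exprD invfM mulrA ler_wpM2l // lef_pV2 ?posrE ?exprn_gt0 ?twoN_gt0 //.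
by rewrite lerXn2r ?nnegrE ?twoN_ge2 // ltW ?twoN_gt0.
Qed.

Let finite_sumE (A : set mindex) (F : mindex -> R) : finite_set A ->
  (\sum_(a \in A) (F a)%:E)%E = (\sum_(a <- fset_set A) F a)%:E.
Proof. by move=> fA; rewrite fsbig_finite //= sumEFin. Qed.

Lemma hnorm_le k C f : l1le k C f -> (hnorm (2 * k) f <= C%:E)%E.
Proof.
move=> fC; have C0 := l1le_ge0 fC.
have -> : C%:E = ((C ^+ 2)%:E `^ 2^-1)%E.
  by rewrite poweR_EFin powR12_sqrt ?sqr_ge0 // sqrtr_sqr ger0_norm.
rewrite /hnorm; apply: gt0_ler_poweR; rewrite ?invr_ge0 //.
- rewrite in_itv /= leey andbT; apply: esum_ge0 => a _.
  by rewrite lee_fin divr_ge0 ?sqr_ge0 ?exprn_ge0 // ltW ?twoN_gt0.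
- by rewrite in_itv /= leey lee_fin sqr_ge0.
apply: ge_ereal_sup => _ [A [finA _] <-]; rewrite finite_sumE // lee_fin.
set s := fset_set A; have us : uniq s by exact: fset_uniq.
have S0 : 0 <= \sum_(a <- s) Normc.normc (f a) / twoN R a ^+ k.
  by apply: sumr_ge0 => a _; exact: term_ge0.
apply: (@le_trans _ _ ((\sum_(a <- s) Normc.normc (f a) / twoN R a ^+ k) ^+ 2));
  last by rewrite lerXn2r ?nnegrE ?fC.
rewrite [leRHS]expr2 big_distrl /= big_seq [leRHS]big_seq.
apply: ler_sum => a sa; rewrite mulnC exprM -expr_div_n expr2.
by rewrite ler_wpM2l // (bigD1_seq a) //= lerDl sumr_ge0.
Qed.

Lemma coef_le_hnorm k f a :
  ((Normc.normc (f a) / twoN R a ^+ k)%:E <= hnorm k f)%E.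
Proof.
set x := _ / _; have x0 : 0 <= x by exact: term_ge0.
have -> : x%:E = ((x ^+ 2)%:E `^ 2^-1)%E.
  by rewrite poweR_EFin powR12_sqrt ?sqr_ge0 // sqrtr_sqr ger0_norm.
have h : ((x ^+ 2)%:E <= \esum_(a in [set: mindex])
            ((Normc.normc (f a)) ^+ 2 * twoN R a ^- k)%:E)%E.
  apply: esum_ge; exists [set a] => //.
  rewrite fsbig_set1 lee_fin /x expr_div_n ler_wpM2l ?sqr_ge0 //.
  rewrite lef_pV2 ?posrE ?exprn_gt0 ?twoN_gt0 // expr2.
  by rewrite ler_peMl ?exprn_ege1 ?twoN_ge1 // exprn_ge0 // ltW ?twoN_gt0.
rewrite /hnorm; apply: gt0_ler_poweR h; rewrite ?invr_ge0 //.
  by rewrite in_itv /= leey lee_fin sqr_ge0.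
rewrite in_itv /= leey andbT; apply: esum_ge0 => b _.
by rewrite lee_fin divr_ge0 ?sqr_ge0 ?exprn_ge0 // ltW ?twoN_gt0.
Qed.

(** The passage from the weighted $\ell^2$ norms to the weighted $\ell^1$ norms
    and back changes the level only: an $\ell^1$ bound squares to an $\ell^2$
    bound at twice the level, and conversely the coefficients of an element of
    $\mathcal H_k$ grow at most like the weight to the power [k], which a
    summable power of the weight compensates. *)
Lemma kondratievP f :
  reflect (exists k, exists C, l1le k C f) (f \in kondratiev R).
Proof.
apply: (iffP idP) => [/asboolP[k _ fk]|[k [C fC]]]; last first.
  apply/asboolP; exists (2 * (k + 1))%N; first by rewrite muln_gt0 addn1.
  by apply: le_lt_trans (hnorm_le (l1le_add 1 fC)) _; rewrite ltry.
have coef := coef_le_hnorm k f; case: (hnorm k f) fk coef => [D|//|]; last first.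
  by move=> _ /(_ 0).
move=> _ coef; have D0 : 0 <= D.
  by apply: le_trans (term_ge0 k f 0) _; rewrite -lee_fin.
(* [D] bounds the coefficients, 2 the sum of the inverse squared weights. *)
exists (k + 2)%N, (D * 2) => s us.
apply: (@le_trans _ _ (D * \sum_(a <- s) (twoN R a ^+ 2)^-1)); last first.
  by rewrite ler_wpM2l ?sum_twoN_le2.
rewrite big_distrr; apply: ler_sum => a _ /=.
rewrite exprD invfM mulrA ler_wpM2r ?invr_ge0 ?sqr_ge0 //.
by rewrite -lee_fin; exact: coef.
Qed.

Lemma kondratiev_subring : subring_closed (kondratiev R).
Proof.
split.
- by apply/kondratievP; exists 0%N, 1; exact: l1le1.
- move=> f g /kondratievP[k [C fC]] /kondratievP[l [D gD]].
  apply/kondratievP; exists (k + l)%N, (C + D); apply: l1leD; first exact: l1le_add.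
  by apply: l1leN; rewrite addnC; exact: l1le_add.
- move=> f g /kondratievP[k [C fC]] /kondratievP[l [D gD]].
  apply/kondratievP; exists (k + l)%N, (C * D); apply: l1leM; first exact: l1le_add.
  by rewrite addnC; exact: l1le_add.
Qed.

HB.instance Definition _ :=
  GRing.isSubringClosed.Build (fps R) (kondratiev R) kondratiev_subring.

Lemma kondratiev_scale (z : R[i]) f :
  f \in kondratiev R -> z *: f \in kondratiev R.
Proof.
move=> /kondratievP[k [C fC]]; apply/kondratievP.
by exists k, (Normc.normc z * C); exact: l1leZ.
Qed.

End WeightedL1.

(** * Absence of zero divisors *)

Section ZeroDivisors.
Variable R : realType.
Implicit Types (f g : fps R) (a b : mindex) (A B : set mindex).

Let argmin_coord A n : A !=set0 ->
  exists2 a, A a & forall a', A a' -> (a n <= a' n)%N.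
Proof.
move=> [a0 Aa0].
have ex : exists k, `[< exists2 a, A a & a n = k >].
  by exists (a0 n); apply/asboolP; exists a0.
case: (ex_minnP ex) => m /asboolP[a Aa <-] min_a; exists a => // a' Aa'.
by apply: min_a; apply/asboolP; exists a'.
Qed.

(** The sum of the smallest elements of [A] and of [B], in the lexicographic
    order that compares the exponents of the last variable first, is a sum in
    one way only.  The induction on the number of variables fixes the exponents
    one at a time, each at its minimum. *)
Lemma unique_sum n A B : A !=set0 -> B !=set0 ->
    (forall a a', A a -> A a' -> forall i, (n <= i)%N -> a i = a' i) ->
    (forall b b', B b -> B b' -> forall i, (n <= i)%N -> b i = b' i) ->
  exists a, exists b, [/\ A a, B b & forall a' b', A a' -> B b' ->
    a' + b' = a + b -> a' = a /\ b' = b].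
Proof.
elim: n A B => [|n IH] A B A0 B0 eqA eqB.
  have [a Aa] := A0; have [b Bb] := B0; exists a, b; split=> // a' b' Aa' Bb' _.
  by split; apply/fsfunP => i; [exact: eqA | exact: eqB].
have [a0 Aa0 min_a] := argmin_coord n A0.
have [b0 Bb0 min_b] := argmin_coord n B0.
have [|||| a [b [[Aa an] [Bb bn] uniq_ab]]] :=
    IH [set a | A a /\ a n = a0 n] [set b | B b /\ b n = b0 n].
- by exists a0.
- by exists b0.
- move=> a a' [Aa an] [Aa' a'n] i; rewrite leq_eqVlt => /orP[/eqP <-|ni].
    by rewrite an a'n.
  exact: eqA.
- move=> b b' [Bb bn] [Bb' b'n] i; rewrite leq_eqVlt => /orP[/eqP <-|ni].
    by rewrite bn b'n.
  exact: eqB.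
exists a, b; split=> // a' b' Aa' Bb' e.
have en : (a' n + b' n = a0 n + b0 n)%N.
  by rewrite -an -bn -!mindexDE e.
have a'n := min_a _ Aa'; have b'n := min_b _ Bb'.
apply: uniq_ab => //; split=> //; apply/eqP; rewrite eqn_leq ?a'n ?b'n andbT.
  by rewrite -(leq_add2r (b0 n)) -en leq_add2l.
by rewrite -(leq_add2l (a0 n)) -en leq_add2r.
Qed.

(** A coefficient of [f * g] at a multi-index in the first [N] variables
    involves the coefficients of [f] and [g] at such multi-indices only, so
    that finitely many variables suffice: enough of them for one nonzero
    coefficient of [f] and one of [g]. *)
Lemma fps_integral f g : f * g = 0 -> f = 0 \/ g = 0.
Proof.
move=> fg0; apply: contrapT => /not_orP[f0 g0].
have nz (h : fps R) : h <> 0 -> exists a, h a != 0.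
  move=> h0; apply: contrapT => /forallNP hz; apply: h0; apply/funext => a.
  by apply/eqP/negPn/negP; exact: hz.
have [a0 fa0] := nz f f0; have [b0 gb0] := nz g g0.
pose N := (\max_(i <- finsupp a0 ++ finsupp b0) i).+1.
pose bounded (a : mindex) := forall i, (N <= i)%N -> a i = 0%N.
have bnd a : {subset finsupp a <= (finsupp a0 ++ finsupp b0 : seq nat)} ->
    bounded a.
  move=> sub i Ni; apply: fsfun_dflt; apply/negP => /sub ia.
  by have := @leq_bigmax_seq _ _ xpredT id _ ia isT; rewrite leqNgt Ni.
have [||||a [b [[fa aN] [gb bN] uniq_ab]]] :=
    @unique_sum N [set a | f a != 0 /\ bounded a] [set b | g b != 0 /\ bounded b].
- by exists a0; split=> //; apply: bnd => i; rewrite mem_cat => ->.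
- by exists b0; split=> //; apply: bnd => i; rewrite mem_cat orbC => ->.
- by move=> a a' [_ aN] [_ a'N] i Ni; rewrite aN ?a'N.
- by move=> a a' [_ aN] [_ a'N] i Ni; rewrite aN ?a'N.
have /eqP := congr1 (fun h : fps R => h (a + b)) fg0.
rewrite (@fps_mul_single _ f g (a + b) a b) //.
  by apply/negP; rewrite mulf_neq0.
move=> a' b' e nz'; apply: uniq_ab => //; split.
- by apply: contraNneq nz' => ->; rewrite mul0r.
- move=> i Ni; apply/eqP; rewrite -leqn0.
  by rewrite (leq_trans (leq_addr (b' i) _)) // -mindexDE e mindexDE aN ?bN.
- by apply: contraNneq nz' => ->; rewrite mulr0.
- move=> i Ni; apply/eqP; rewrite -leqn0.
  by rewrite (leq_trans (leq_addl (a' i) _)) // -mindexDE e mindexDE aN ?bN.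
Qed.

End ZeroDivisors.

(** * Order of vanishing *)

Section Order.
Variable R : realType.
Implicit Types (f g : fps R) (N : nat).

(** A multiplicative filtration of the power series ring.  The order of a
    monomial is the logarithm of its weight instead of its degree; the weight
    is multiplicative as well, and at least 2 on nonconstant monomials. *)
Definition ord_ge N f := forall a, twoN R a < 2 ^+ N -> f a = 0.

Lemma ord_ge0 f : ord_ge 0 f.
Proof. by move=> a; rewrite expr0 ltNge twoN_ge1. Qed.

Lemma ord_ge_trans M N f : (M <= N)%N -> ord_ge N f -> ord_ge M f.
Proof.
move=> MN fN a aM; apply: fN; apply: lt_le_trans aM _.
by rewrite ler_eXn2l ?ltr1n.
Qed.

Lemma ord_geD N f g : ord_ge N f -> ord_ge N g -> ord_ge N (f + g).
Proof. by move=> fN gN a aN; rewrite fpsDE fN ?gN ?addr0. Qed.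

Lemma ord_geN N f : ord_ge N f -> ord_ge N (- f).
Proof. by move=> fN a aN; rewrite fpsNE fN ?oppr0. Qed.

Lemma ord_ge_sum N (I : Type) (s : seq I) (P : pred I) (F : I -> fps R) :
  (forall i, P i -> ord_ge N (F i)) -> ord_ge N (\sum_(i <- s | P i) F i).
Proof.
move=> FN; elim/big_rec: _ => [//|i f Pi fN].
by apply: ord_geD => //; exact: FN.
Qed.

Lemma ord_geM M N f g : ord_ge M f -> ord_ge N g -> ord_ge (M + N) (f * g).
Proof.
move=> fM gN a aMN; apply: fps_mul_eq0 => b c bca.
have [/fM->|bM] := ltP (twoN R b) (2 ^+ M); first by rewrite mul0r.
have [/gN->|cN] := ltP (twoN R c) (2 ^+ N); first by rewrite mulr0.
move: aMN; rewrite -bca twoND exprD ltNge ler_pM ?exprn_ge0 //.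
Qed.

Lemma ord_geMr N f g : ord_ge N f -> ord_ge N (f * g).
Proof. by move=> fN; rewrite -[N]addn0; apply: ord_geM => //; exact: ord_ge0. Qed.

Lemma ord_geMl N f g : ord_ge N g -> ord_ge N (f * g).
Proof. by rewrite mulrC; exact: ord_geMr. Qed.

Lemma ord_ge1 f : const_coef f = 0 -> ord_ge 1 f.
Proof.
move=> f0 a; have [->|/twoN_ge2 a2] := eqVneq a 0; first by [].
by rewrite expr1 ltNge a2.
Qed.

Lemma ord_geX f n : const_coef f = 0 -> ord_ge n (f ^+ n).
Proof.
move=> f0; elim: n => [|n IH]; first exact: ord_ge0.
by rewrite exprS -add1n; apply: ord_geM => //; exact: ord_ge1.
Qed.

Lemma exp2_gt (y : R) : exists n, y < 2 ^+ n.
Proof.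
have [y0|y0] := ltP y 0; first by exists 0%N; rewrite (lt_trans y0) ?ltr01.
exists (Num.bound y); apply: lt_trans (archi_boundP y0) _.
by rewrite -natrX ltr_nat ltn_expl.
Qed.

Lemma twoN_lt_exp2 (s : seq mindex) M : exists2 N, (M <= N)%N &
  forall a, a \in s -> twoN R a < 2 ^+ N.
Proof.
elim: s => [|a s [N MN sN]]; first by exists M.
have [n an] := exp2_gt (twoN R a); exists (maxn n N).
  by rewrite leq_max MN orbT.
move=> b; rewrite inE => /predU1P[->|/sN bN].
  by apply: lt_le_trans an _; rewrite ler_eXn2l ?ltr1n ?leq_maxl.
by apply: lt_le_trans bN _; rewrite ler_eXn2l ?ltr1n ?leq_maxr.
Qed.

Lemma ord_ge_eq0 f : (forall N, ord_ge N f) -> f = 0.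
Proof.
move=> fN; apply/funext => a.
have [N _ aN] := twoN_lt_exp2 [:: a] 0.
by apply: (fN N); rewrite aN ?mem_head.
Qed.

End Order.

(** * Partial sums of power series in a matrix *)

Section PartialSums.
Variables (R : realType) (p : nat).
Implicit Types (x : nat -> R[i]) (r X : 'M[fps R]_p) (N : nat).

Definition psum x r N : 'M[fps R]_p := \sum_(n < N) (x n)%:A *: r ^+ n.

Lemma psumS x r N : psum x r N.+1 = psum x r N + (x N)%:A *: r ^+ N.
Proof. by rewrite /psum big_ord_recr. Qed.

Lemma mx_ord_geX r n i j : map_mx (@const_coef R) r = 0 ->
  ord_ge n ((r ^+ n) i j).
Proof.
move=> r0; elim: n i j => [|n IH] i j; first exact: ord_ge0.
rewrite exprSr -mulmxE mxE; apply: ord_ge_sum => l _; rewrite -addn1.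
apply: ord_geM => //; apply: ord_ge1.
by have /matrixP /(_ l j) := r0; rewrite !mxE.
Qed.

Lemma psum_ord_ge x r N d i j : map_mx (@const_coef R) r = 0 ->
  ord_ge N (psum x r (N + d) i j - psum x r N i j).
Proof.
move=> r0; elim: d => [|d IH]; first by rewrite addn0 subrr.
rewrite addnS psumS mxE addrAC; apply: ord_geD => //; rewrite mxE.
apply/ord_geMl; apply: (@ord_ge_trans _ _ (N + d)); first exact: leq_addr.
exact: mx_ord_geX.
Qed.

(** The sum of the power series as a formal object: if [r] has no constant
    term, then [r ^+ n] vanishes to order [n], every coefficient of the partial
    sums is eventually constant, and [X] collects these constants. *)
Definition formal_sum x r X := forall N i j, ord_ge N (X i j - psum x r N i j).

Lemma formal_sum_exists x r : map_mx (@const_coef R) r = 0 ->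
  exists X, formal_sum x r X.
Proof.
move=> r0.
have /choice[M aM] : forall a, exists N, twoN R a < 2 ^+ N.
  by move=> a; exact: exp2_gt.
exists (\matrix_(i, j) ((fun a => psum x r (M a) i j a) : fps R)) => N i j a aN.
rewrite mxE fpsDE fpsNE /=.
have [NM|/ltnW MN] := leqP N (M a).
  by have := psum_ord_ge x (M a - N)%N i j r0 aN; rewrite subnKC.
have := psum_ord_ge x (N - M a)%N i j r0 (aM a); rewrite subnKC //.
by rewrite fpsDE fpsNE => /eqP; rewrite subr_eq0 => /eqP ->; rewrite subrr.
Qed.

Lemma formal_sum_unique x r X Y :
  formal_sum x r X -> formal_sum x r Y -> X = Y.
Proof.
move=> rX rY; apply/matrixP => i j; apply/eqP; rewrite -subr_eq0; apply/eqP.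
apply: ord_ge_eq0 => N.
have -> : X i j - Y i j =
    (X i j - psum x r N i j) - (Y i j - psum x r N i j) by ring.
by apply: ord_geD; [exact: rX | apply/ord_geN; exact: rY].
Qed.

End PartialSums.

(** * Convergence in the inductive limit topology *)

Section Convergence.
Variable R : realType.
Implicit Types (f g : fps R) (x y : nat -> R[i]).

Lemma normc_convex (z w : R[i]) : `|z| + `|w| <= 1 ->
  Normc.normc z + Normc.normc w <= 1.
Proof.
have -> : `|z| = (Normc.normc z)%:C%C by case: z.
have -> : `|w| = (Normc.normc w)%:C%C by case: w.
by rewrite -rmorphD -[1]/(1%:C%C) lecR.
Qed.

(** The sets of series with one small coefficient are neighbourhoods of 0, so
    convergence in the inductive limit implies coefficientwise convergence. *)
Lemma indlim_nbhs0_coef a (e : R) : 0 < e ->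
  indlim_nbhs0 [set f | f \in kondratiev R /\ Normc.normc (f a) <= e].
Proof.
move=> e0; split.
- by move=> f [].
- move=> f g [fK fe] [gK ge] z w zw; split.
    by apply: rpredD; exact: kondratiev_scale.
  rewrite -[(z *: f + w *: g) a]/(z * f a + w * g a).
  apply: le_trans (le_normcD _ _) _; rewrite !Normc.normcM.
  apply: (@le_trans _ _ (Normc.normc z * e + Normc.normc w * e)).
    by rewrite lerD // ler_wpM2l ?normc_ge0.
  by rewrite -mulrDl ger_pMl ?normc_convex.
- move=> k k0; have wk : 0 < twoN R a ^+ k by rewrite exprn_gt0 ?twoN_gt0.
  exists (e / twoN R a ^+ k); first exact: divr_gt0.
  move=> f fe; split.
    by apply/asboolP; exists k => //; apply: lt_trans fe _; rewrite ltry.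
  have := le_lt_trans (coef_le_hnorm k f a) fe.
  by rewrite lte_fin ltr_pM2r ?invr_gt0 // => /ltW.
Qed.

Lemma indlim_cvg_coef (u : nat -> fps R) f a (e : R) : 0 < e ->
  indlim_cvg u f -> \forall n \near \oo, Normc.normc ((u n - f) a) <= e.
Proof.
move=> e0 [_ /(_ _ (indlim_nbhs0_coef a e0))].
by apply: filterS => n [].
Qed.

(** Each neighbourhood of 0 contains a ball of $\mathcal H_k$ for every [k];
    hence convergence at one level suffices. *)
Lemma indlim_cvg_l1le (u : nat -> fps R) f k (C : R) :
    f \in kondratiev R -> (forall N, l1le k (C / 2 ^+ N) (f - u N)) ->
  indlim_cvg u f.
Proof.
move=> fK fu; split=> // V [_ _ Vball].
(* [hnorm_le] doubles the level, and [k + 1] makes it positive. *)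
have [|e e0 eV] := Vball (2 * (k + 1))%N; first by rewrite muln_gt0 addn1.
have [n Cn] := exp2_gt (C / e).
exists n => // N /= nN; apply: eV.
have h : l1le k (C / 2 ^+ N) (u N - f).
  by rewrite -opprB; apply: l1leN; exact: fu.
apply: le_lt_trans (hnorm_le (l1le_add 1 h)) _.
rewrite lte_fin ltr_pdivrMr ?exprn_gt0 // mulrC -ltr_pdivrMr //.
by apply: lt_le_trans Cn _; rewrite ler_eXn2l ?ltr1n.
Qed.

Section Matrix.
Variable p : nat.
Implicit Types r X : 'M[fps R]_p.

(** Eventually constant coefficients attain their limit. *)
Lemma funcalc_formal_sum x r X : map_mx (@const_coef R) r = 0 ->
  funcalc x r X -> formal_sum x r X.
Proof.
move=> r0 rX N i j a aN; apply: Normc.eq0_normc.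
apply/eqP; rewrite eq_le normc_ge0 andbT.
apply/ler_addgt0Pl => e e0; rewrite addr0.
have [M _ /(_ (N + M)%N)] := indlim_cvg_coef a e0 (rX i j).
rewrite /= leq_addl => /(_ isT); apply: le_trans.
rewrite -[\sum_(n < N + M) _]/(psum x r (N + M)) -normcN.
rewrite le_eqVlt; apply/orP; left; apply/eqP; congr Normc.normc.
have := psum_ord_ge x M i j r0 aN.
rewrite !fpsDE !fpsNE => /eqP; rewrite subr_eq0 => /eqP <-.
by rewrite opprB.
Qed.

Lemma l1le_mx r : r \is a mxOver (kondratiev R) ->
  exists k, exists C, forall i j, l1le k C (r i j).
Proof.
move=> /mxOverP rK.
have /fin_all_exists[c rc] (q : 'I_p * 'I_p) :
    exists c : nat * R, l1le c.1 c.2 (r q.1 q.2).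
  by have /kondratievP[k [C rC]] := rK q.1 q.2; exists (k, C).
exists (\sum_q (c q).1)%N, (\sum_q (c q).2) => i j.
rewrite (bigD1 (i, j)) //=; apply: l1le_add.
apply: l1le_trans (rc (i, j)); rewrite (bigD1 (i, j)) //= lerDl.
by apply: sumr_ge0 => q _; exact: l1le_ge0 (rc q).
Qed.

Lemma l1le_mxX k (e : R) r : (forall i j, l1le k e (r i j)) ->
  forall n i j, l1le k ((p%:R * e) ^+ n) ((r ^+ n) i j).
Proof.
move=> re; elim=> [|n IH] i j.
  rewrite expr0 mxE; case: (i == j); first exact: l1le1.
  by move=> s us; rewrite big1 // => a _; rewrite Normc.normc0 mul0r.
rewrite [r ^+ _]exprSr -mulmxE mxE.
have -> : (p%:R * e) ^+ n.+1 = \sum_(l < p) (p%:R * e) ^+ n * e.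
  by rewrite sumr_const card_ord exprSr -mulr_natl; ring.
by apply: l1le_sum => l; apply: l1leM.
Qed.

(** At a level where the entries of [r] are small enough, the terms
    [x n *: r ^+ n] decrease geometrically. *)
Lemma formal_sum_l1le x r X (C rho : R) : 0 <= rho ->
    (forall n, Normc.normc (x n) <= C * rho ^+ n) ->
    r \is a mxOver (kondratiev R) -> map_mx (@const_coef R) r = 0 ->
    formal_sum x r X ->
  exists k, forall N i j, l1le k (2 * C / 2 ^+ N) (X i j - psum x r N i j).
Proof.
move=> rho0 xC rK r0 rX.
have C0 : 0 <= C by have := xC 0%N; rewrite expr0 mulr1; apply: le_trans (normc_ge0 _).
have [k [D rD]] := l1le_mx rK.
(* At level [k + m] the entries are at most [e], and [rho * p * e <= 1 / 2]. *)
have [m Dm] := exp2_gt (2 * p%:R * D * rho).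
pose e := D / 2 ^+ m; exists (k + m)%N.
have re i j : l1le (k + m) e (r i j).
  apply: l1le_shrink (rD i j).
  by have /matrixP /(_ i j) := r0; rewrite !mxE.
have D0 (i j : 'I_p) : 0 <= D by exact: l1le_ge0 (rD i j).
have rhoe (i j : 'I_p) : 0 <= rho * (p%:R * e) <= 2^-1.
  have m0 : 0 < 2 ^+ m :> R by rewrite exprn_gt0.
  rewrite /e !mulr_ge0 ?(D0 i j) ?invr_ge0 ?exprn_ge0 //=.
  rewrite !mulrA ler_pdivrMr // ler_pdivlMl // ltW //.
  by apply: le_lt_trans Dm; rewrite le_eqVlt; apply/orP; left; apply/eqP; ring.
have tail N d i j : l1le (k + m) (2 * C / 2 ^+ N - 2 * C / 2 ^+ (N + d))
    (psum x r (N + d) i j - psum x r N i j).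
  elim: d => [|d IH].
    rewrite addn0 !subrr => s us.
    by rewrite big1 // => a _; rewrite Normc.normc0 mul0r.
  rewrite addnS psumS mxE addrAC.
  have -> : 2 * C / 2 ^+ N - 2 * C / 2 ^+ (N + d).+1 =
      (2 * C / 2 ^+ N - 2 * C / 2 ^+ (N + d)) + C / 2 ^+ (N + d).
    by rewrite exprS; field; rewrite !expf_neq0 ?pnatr_eq0.
  apply: l1leD => //; rewrite mxE mulr_algl.
  apply: l1le_trans (l1leZ _ (l1le_mxX re _ _ _)).
  apply: le_trans (ler_wpM2r _ (xC _)) _.
    by rewrite exprn_ge0 // mulr_ge0 //; exact: l1le_ge0 (re i j).
  rewrite -mulrA -exprMn ler_wpM2l // -exprVn lerXn2r ?nnegrE ?invr_ge0 //.
    by have /andP[] := rhoe i j.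
  by have /andP[] := rhoe i j.
move=> N i j s us.
(* On the finitely many coefficients in [s], [X] is a partial sum. *)
have [M NM sM] := twoN_lt_exp2 R s N.
have := tail N (M - N)%N i j; rewrite subnKC // => /(_ s us).
move=> h; apply: le_trans (le_trans h _); last first.
  by rewrite lerBlDr lerDl divr_ge0 ?mulr_ge0 ?exprn_ge0.
rewrite le_eqVlt; apply/orP; left; apply/eqP; apply: eq_big_seq => a sa.
have := rX M i j a (sM a sa); rewrite !fpsDE !fpsNE => /eqP.
by rewrite subr_eq0 => /eqP ->.
Qed.

Lemma formal_sum_funcalc x r X (C rho : R) : 0 <= rho ->
    (forall n, Normc.normc (x n) <= C * rho ^+ n) ->
    r \is a mxOver (kondratiev R) -> map_mx (@const_coef R) r = 0 ->
    formal_sum x r X ->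
  X \is a mxOver (kondratiev R) /\ funcalc x r X.
Proof.
move=> rho0 xC rK r0 rX; have [k Xk] := formal_sum_l1le rho0 xC rK r0 rX.
have XK i j : X i j \in kondratiev R.
  apply/kondratievP; exists k, (2 * C / 2 ^+ 0).
  by have := Xk 0%N i j; rewrite /psum big_ord0 [X in _ - X]mxE subr0.
split; first by apply/mxOverP.
by move=> i j; apply: (@indlim_cvg_l1le _ _ k (2 * C)).
Qed.

End Matrix.

(** The terms of the series are bounded at a point of convergence other
    than 0. *)
Lemma conv_radius_bound x : (0 < conv_radius x)%E ->
  exists C : R, exists2 rho : R, 0 <= rho &
    forall n, Normc.normc (x n) <= C * rho ^+ n.
Proof.
move=> /ereal_sup_gt[_ [t /= xt <-]]; rewrite lte_fin => t0.
have /cvg_seq_bounded : cvgn ((fun n => x n * t ^+ n) : nat -> R[i]^o).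
  by apply/cvg_ex; exists 0; exact: cvg_series_cvg_0 xt.
move=> [M [Mreal /(_ (M + 1))]]; rewrite ltrDl ltr01 => /(_ isT) xM.
exists (complex.Re (M + 1)), (Normc.normc t)^-1; first by rewrite invr_ge0 ltW.
move=> n; rewrite exprVn ler_pdivlMr ?exprn_gt0 //.
have -> : Normc.normc t ^+ n = Normc.normc (t ^+ n).
  by elim: n => [|n IH]; rewrite ?expr0 ?Normc.normc1 // !exprS Normc.normcM IH.
rewrite -Normc.normcM; have : `|x n * t ^+ n| <= M + 1 := xM n I.
have -> : `|x n * t ^+ n| = (Normc.normc (x n * t ^+ n))%:C%C.
  by case: (x n * t ^+ n).
by rewrite lecE => /andP[_].
Qed.

End Convergence.

(** * Products and inverses *)

Section ScalarSums.
Variable R : realType.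
Implicit Types (x y : nat -> R[i]) (r X Y : fps R) (P Q : {poly R[i]}).

Definition spsum x r N : fps R := \sum_(n < N) (x n)%:A * r ^+ n.

Lemma psum_scalar x r N : psum x (r%:M : 'M[fps R]_1) N = (spsum x r N)%:M.
Proof.
rewrite /psum /spsum rmorph_sum; apply: eq_bigr => n _ /=.
by rewrite -rmorphXn /= scale_scalar_mx.
Qed.

Lemma formal_sum_scalar x r X : formal_sum x (r%:M : 'M[fps R]_1) X%:M <->
  forall N, ord_ge N (X - spsum x r N).
Proof.
split=> [h N|h N i j].
  by have := h N 0 0; rewrite psum_scalar !mxE eqxx.
by rewrite psum_scalar !ord1 !mxE eqxx; exact: h.
Qed.

(** Truncated sums are values of this ring morphism, so that their products
    can be computed on polynomials. *)
Let ev r P : fps R := (map_poly (in_alg (fps R)) P).[r].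

Let ev_poly r x N : ev r (\poly_(n < N) x n) = spsum x r N.
Proof.
rewrite /ev /spsum -(horner_poly N (fun n => (x n)%:A)); congr (_.[r]); apply/polyP => n.
by rewrite coef_map !coef_poly; case: ifP => // _; rewrite /= scale0r.
Qed.

Let ev_ord_ge r P N : const_coef r = 0 ->
  (forall n, (n < N)%N -> P`_n = 0) -> ord_ge N (ev r P).
Proof.
move=> r0 PN; rewrite /ev horner_coef; apply: ord_ge_sum => n _.
rewrite coef_map /=; have [nN|Nn] := ltnP n N.
  by rewrite PN // scale0r mul0r => a _.
by apply/ord_geMl; apply: ord_ge_trans Nn _; exact: ord_geX.
Qed.

(** The polynomial identity holds in all degrees below [N], and the powers
    [r ^+ n] of higher degree vanish to order [N]. *)
Lemma spsum_mul x y r N : const_coef r = 0 ->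
  ord_ge N (spsum x r N * spsum y r N - spsum (cauchy_prod x y) r N).
Proof.
move=> r0; rewrite -!ev_poly.
have -> : forall P Q S, ev r P * ev r Q - ev r S = ev r (P * Q - S).
  by move=> P Q S; rewrite /ev rmorphB rmorphM !hornerE.
apply: ev_ord_ge => // n nN; rewrite coefB coefM coef_poly nN /cauchy_prod.
apply/eqP; rewrite subr_eq0; apply/eqP; apply: eq_bigr => k _.
rewrite !coef_poly (leq_ltn_trans (leq_subr _ _) nN).
by rewrite (leq_ltn_trans _ nN) // -ltnS.
Qed.

Lemma formal_sum_mul x y r X Y : const_coef r = 0 ->
    formal_sum x (r%:M : 'M[fps R]_1) X%:M -> formal_sum y (r%:M : 'M[fps R]_1) Y%:M ->
  formal_sum (cauchy_prod x y) (r%:M : 'M[fps R]_1) (X * Y)%:M.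
Proof.
move=> r0 /formal_sum_scalar rX /formal_sum_scalar rY.
apply/formal_sum_scalar => N.
have -> : X * Y - spsum (cauchy_prod x y) r N =
    (X - spsum x r N) * Y + spsum x r N * (Y - spsum y r N) +
    (spsum x r N * spsum y r N - spsum (cauchy_prod x y) r N) by ring.
apply: ord_geD; last exact: spsum_mul.
by apply: ord_geD; [exact: ord_geMr | exact: ord_geMl].
Qed.

(** The factor $2^n$ absorbs the number $n + 1$ of terms of the coefficient. *)
Lemma cauchy_prod_bound x y (C D rho sigma : R) : 0 <= rho -> 0 <= sigma ->
    (forall n, Normc.normc (x n) <= C * rho ^+ n) ->
    (forall n, Normc.normc (y n) <= D * sigma ^+ n) ->
  forall n, Normc.normc (cauchy_prod x y n) <=
            C * D * (2 * Num.max rho sigma) ^+ n.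
Proof.
move=> rho0 sigma0 xC yD n; set M := Num.max _ _.
have M0 : 0 <= M by rewrite le_max rho0.
have C0 : 0 <= C.
  by have := xC 0%N; rewrite expr0 mulr1; apply: le_trans (normc_ge0 _).
have D0 : 0 <= D.
  by have := yD 0%N; rewrite expr0 mulr1; apply: le_trans (normc_ge0 _).
apply: le_trans (normc_sum _ _) _.
apply: (@le_trans _ _ (\sum_(k < n.+1) C * D * M ^+ n)).
  apply: ler_sum => k _; rewrite Normc.normcM.
  have kn : (k <= n)%N by rewrite -ltnS.
  have -> : M ^+ n = M ^+ k * M ^+ (n - k) by rewrite -exprD subnKC.
  rewrite mulrACA ler_pM ?normc_ge0 //.
    apply: le_trans (xC k) _; rewrite ler_wpM2l // lerXn2r ?nnegrE //.
    by rewrite le_max lexx.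
  apply: le_trans (yD _) _; rewrite ler_wpM2l // lerXn2r ?nnegrE //.
  by rewrite le_max lexx orbT.
rewrite sumr_const card_ord -[leLHS]mulr_natl exprMn [leRHS]mulrCA.
by rewrite ler_wpM2r ?mulr_ge0 ?exprn_ge0 // -natrX ler_nat ltn_expl.
Qed.

Lemma spsum_geometric r N : (1 - r) * spsum (fun=> 1) r N = 1 - r ^+ N.
Proof.
rewrite -[RHS]opprB subrX1 -mulNr opprB /spsum; congr (_ * _).
by apply: eq_bigr => n _; rewrite scale1r mul1r.
Qed.

(** The geometric series in [1 - d / const_coef d]. *)
Lemma kondratiev_inv d : d \in kondratiev R -> const_coef d != 0 ->
  exists2 e, e \in kondratiev R & d * e = 1.
Proof.
move=> dK d0; pose c := (const_coef d)^-1.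
pose r := 1 - c *: d.
have r0 : const_coef r = 0.
  have cdE : const_coef (c *: d) = c * const_coef d by [].
  by rewrite rmorphB rmorph1 /= cdE mulVf // subrr.
have rK : r \in kondratiev R.
  by apply: rpredB; [exact: rpred1 | exact: kondratiev_scale].
have mr0 : map_mx (@const_coef R) (r%:M : 'M[fps R]_1) = 0.
  by apply/matrixP => i j; rewrite !mxE !ord1 eqxx.
have mrK : (r%:M : 'M[fps R]_1) \is a mxOver (kondratiev R).
  by apply/mxOverP => i j; rewrite !mxE !ord1 eqxx.
pose x : nat -> R[i] := fun=> 1.
have xb n : Normc.normc (x n) <= 1 * 1 ^+ n :> R.
  by rewrite Normc.normc1 expr1n mulr1.
have [X rX] := formal_sum_exists x mr0.
have [/mxOverP XK _] := formal_sum_funcalc ler01 xb mrK mr0 rX.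
have {rX} XE N : ord_ge N (X 0 0 - spsum x r N).
  by have := rX N 0 0; rewrite psum_scalar !mxE eqxx.
exists (c *: X 0 0); first exact: kondratiev_scale.
have -> : d * (c *: X 0 0) = (1 - r) * X 0 0.
  by rewrite /r opprB addrC subrK mulrC -scalerAl mulrC -scalerAl.
apply/eqP; rewrite -subr_eq0; apply/eqP; apply: ord_ge_eq0 => N.
have -> : (1 - r) * X 0 0 - 1 =
    (1 - r) * (X 0 0 - spsum x r N) + ((1 - r) * spsum x r N - 1) by ring.
apply: ord_geD; first exact/ord_geMl.
by rewrite spsum_geometric addrAC subrr sub0r; apply/ord_geN; exact: ord_geX.
Qed.

End ScalarSums.

Section Invertibility.
Variable R : realType.

Lemma det_kondratiev n (A : 'M[fps R]_n) :
  A \is a mxOver (kondratiev R) -> \det A \in kondratiev R.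
Proof.
move=> /mxOverP AK; rewrite rpred_sum // => s _; rewrite rpredM ?rpred_sign //.
by rewrite rpred_prod.
Qed.

Lemma adj_kondratiev n (A : 'M[fps R]_n) :
  A \is a mxOver (kondratiev R) -> \adj A \is a mxOver (kondratiev R).
Proof.
move=> /mxOverP AK; apply/mxOverP => i j; rewrite mxE /cofactor.
rewrite rpredM ?rpred_sign //; apply: det_kondratiev; apply/mxOverP => k l.
by rewrite !mxE.
Qed.

(** The determinant commutes with taking constant coefficients, and the
    adjugate reduces the inversion of [s] to that of its determinant. *)
Lemma kondratiev_mx_invertible p (s : 'M[fps R]_p) :
    s \is a mxOver (kondratiev R) ->
  (exists t : 'M[fps R]_p,
     [/\ t \is a mxOver (kondratiev R), s *m t = 1%:M & t *m s = 1%:M])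
  <-> map_mx (@const_coef R) s \in unitmx.
Proof.
move=> sK; split=> [[t [_ st _]]|s0].
  have /mulmx1_unit[] // : map_mx (@const_coef R) s *m map_mx (@const_coef R) t
      = 1%:M.
  by rewrite -map_mxM st map_mx1.
have [|e eK de] := kondratiev_inv (det_kondratiev sK).
  by move: s0; rewrite unitmxE unitfE det_map_mx.
exists (e *: \adj s); split.
- apply/mxOverP => i j; rewrite mxE rpredM //.
  by have /mxOverP := adj_kondratiev sK.
- by rewrite -scalemxAr mul_mx_adj scale_scalar_mx mulrC de.
- by rewrite -scalemxAl mul_adj_mx scale_scalar_mx mulrC de.
Qed.

End Invertibility.

Theorem theorem3p3 (R : realType) :
  [/\ [/\ subring_closed (kondratiev R),
          forall z : R[i], z%:A \in kondratiev R,
          injective (fun z : R[i] => z%:A : fps R)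
        & forall f g : fps R, f \in kondratiev R -> g \in kondratiev R ->
            f * g = 0 -> f = 0 \/ g = 0],
      forall x : nat -> R[i], (0 < conv_radius x)%E ->
        forall p : nat, (0 < p)%N ->
        forall r : 'M[fps R]_p, r \is a mxOver (kondratiev R) ->
          map_mx (@const_coef R) r = 0 ->
          exists! X : 'M[fps R]_p,
            X \is a mxOver (kondratiev R) /\ funcalc x r X,
      forall x y : nat -> R[i],
        (0 < conv_radius x)%E -> (0 < conv_radius y)%E ->
        forall r : fps R, r \in kondratiev R -> const_coef r = 0 ->
        forall X Y : fps R,
          funcalc x (r%:M : 'M[fps R]_1) X%:M ->
          funcalc y (r%:M : 'M[fps R]_1) Y%:M ->
          funcalc (cauchy_prod x y) (r%:M : 'M[fps R]_1) (X * Y)%:M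
    & forall p : nat, (0 < p)%N ->
        forall s : 'M[fps R]_p, s \is a mxOver (kondratiev R) ->
          (exists t : 'M[fps R]_p,
             [/\ t \is a mxOver (kondratiev R), s *m t = 1%:M & t *m s = 1%:M])
          <-> map_mx (@const_coef R) s \in unitmx].
Proof.
split; first split.
- exact: kondratiev_subring.
- by move=> z; apply: kondratiev_scale; exact: rpred1.
- move=> z w /(congr1 (@const_coef R)).
  by rewrite /const_coef !fps_algE eqxx !mulr1.
- by move=> f g _ _; exact: fps_integral.
- move=> x /conv_radius_bound[C [rho rho0 xC]] p _ r rK r0.
  have [X rX] := formal_sum_exists x r0.
  exists X; split; first exact: formal_sum_funcalc rho0 xC rK r0 rX.
  move=> Y [_ /(funcalc_formal_sum r0) rY].
  exact: formal_sum_unique rX rY.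
- move=> x y /conv_radius_bound[C [rho rho0 xC]].
  move=> /conv_radius_bound[D [sigma sigma0 yD]] r rK r0 X Y.
  have mr0 : map_mx (@const_coef R) (r%:M : 'M[fps R]_1) = 0.
    by apply/matrixP => i j; rewrite !mxE !ord1 eqxx.
  have mrK : (r%:M : 'M[fps R]_1) \is a mxOver (kondratiev R).
    by apply/mxOverP => i j; rewrite !mxE !ord1 eqxx.
  move=> /(funcalc_formal_sum mr0) rX /(funcalc_formal_sum mr0) rY.
  have M0 : 0 <= 2 * Num.max rho sigma by rewrite mulr_ge0 // le_max rho0.
  have [_ rXY] := formal_sum_funcalc M0
    (cauchy_prod_bound rho0 sigma0 xC yD) mrK mr0 (formal_sum_mul r0 rX rY).
  exact: rXY.
- by move=> p _ s; exact: kondratiev_mx_invertible.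
Qed.
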